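(* There exists no function $\mathbf{f}:\mathbb{N}\to\mathbb{N}$ such that, for every $d\in\mathbb{N}$ and every arc-transitive graph $(\Gamma,G)$ of valency $d$, one has $\mathbf{d}(G)\le \mathbf{f}(d)$.
   Context: Graphs are simple and undirected. An arc of a graph is an ordered pair of adjacent vertices. An arc-transitive graph is a pair $(\Gamma,G)$ where $\Gamma$ is a locally finite connected graph and $G$ is a subgroup of $\mathrm{Aut}(\Gamma)$ (i.e. $G$ acts faithfully on $\Gamma$ by graph automorphisms) that acts transitively on the arcs of $\Gamma$, such that for every vertex $\alpha$ of $\Gamma$ the vertex-stabilizer $G_\alpha$ is finite. The valency of $(\Gamma,G)$ is the common valency of the vertices of $\Gamma$, i.e. the number of neighbours of any vertex. For a group $G$, $\mathbf{d}(G)$ denotes the minimal number of generators of $G$. *)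

(* Defs.v *)
From mathcomp Require Import all_boot.
From mathcomp Require Import classical_sets cardinality.

Set Implicit Arguments.
Unset Strict Implicit.
Unset Printing Implicit Defensive.

Local Open Scope classical_set_scope.
Local Open Scope group_scope.

(* The vertex set may be infinite. *)
Record sgraph := SGraph {
  vertex :> Type;
  adj : rel vertex;
  adj_sym : symmetric adj;
  adj_irr : irreflexive adj }.

Definition neighbours (Gam : sgraph) (x : Gam) : set Gam :=
  [set y | adj x y].

Definition locally_finite (Gam : sgraph) : Prop :=
  forall x : Gam, finite_set (neighbours x).

(* Connected graphs are taken to be nonempty, so that the valency of a
   connected arc-transitive graph is unique. *)
Definition connected_graph (Gam : sgraph) : Prop :=
  inhabited Gam /\
  forall x y : Gam, exists2 p : seq Gam, path (@adj Gam) x p & last x p = y.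

Definition has_valency (Gam : sgraph) (d : nat) : Prop :=
  forall x : Gam, (neighbours x #= `I_d)%card.

(* A subgroup of Aut(Gam) is given as an abstract, possibly infinite, group G
   with a faithful left action on Gam; invertibility of each act g follows from
   the action laws. *)
Record faithful_graph_action (Gam : sgraph) (G : groupType)
    (act : G -> Gam -> Gam) : Prop := FaithfulGraphAction {
  act1 : forall x, act 1 x = x;
  actM : forall g h x, act (g * h) x = act g (act h x);
  act_adj : forall g x y, adj (act g x) (act g y) = adj x y;
  act_faithful : forall g, (forall x, act g x = x) -> g = 1 }.

Definition transitive_on_arcs (Gam : sgraph) (G : groupType)
    (act : G -> Gam -> Gam) : Prop :=
  forall x y x' y' : Gam, adj x y -> adj x' y' ->
    exists g : G, act g x = x' /\ act g y = y'.

Definition stabilizer (Gam : sgraph) (G : groupType)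
    (act : G -> Gam -> Gam) (x : Gam) : set G :=
  [set g | act g x = x].

Record arc_transitive_graph (Gam : sgraph) (G : groupType)
    (act : G -> Gam -> Gam) : Prop := ArcTransitiveGraph {
  atg_locally_finite : locally_finite Gam;
  atg_connected : connected_graph Gam;
  atg_action : faithful_graph_action act;
  atg_arcs : transitive_on_arcs act;
  atg_stab_finite : forall x : Gam, finite_set (stabilizer act x) }.

Definition generated_subgroup (G : groupType) (A : set G) : set G :=
  smallest (fun H : set G => group_closed (mem H)) A.

Definition generates (G : groupType) (s : seq G) : Prop :=
  generated_subgroup [set` s] = setT.

(* d(G) = n. No n satisfies this when G is not finitely generated, which is
   the case d(G) = oo. *)
Definition min_generators (G : groupType) (n : nat) : Prop :=
  (exists2 s : seq G, size s = n & generates s) /\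
  (forall s : seq G, generates s -> n <= size s).

(* d(G) <= m *)
Definition min_generators_le (G : groupType) (m : nat) : Prop :=
  exists2 n, min_generators G n & n <= m.

(* Main.v *)
Require Import Defs.
From mathcomp Require Import all_boot all_algebra all_fingroup.
From mathcomp Require Import boolp classical_sets cardinality functions.
From mathcomp Require Import zify.

(** A fixed valency does not bound the number of generators, because a group
of vertex-switchings can be a module needing many generators under a
symmetry group that itself needs few.

Let [Sigma] be a finite connected graph with a group [X] of automorphisms
transitive on arcs, and let [C] be an [X]-invariant group of functions from
the vertices to F_2.  Replace each vertex [v] by the pair [(v, 0), (v, 1)],
joining all vertices over adjacent [v] and [w]; the valency doubles.  The
group [C : X] acts faithfully by [(v, i) |-> (h v, i + c v)].  It is
arc-transitive as soon as [C] contains the constants and separates the ends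
of every edge: a constant plus a multiple of a separating function takes
any two prescribed values on an edge.  An additive map [lam : C -> F_2^t]
that is [X]-invariant and onto extends to a homomorphism from [C : X] onto
F_2^t, so at least [t] generators are needed.  This is the lemma
[exists_arc_transitive_of_large_rank].

Now take [Sigma] to be the n x n torus grid with n a power of 2, so that
[Sigma] has valency 4 whatever n is.  With D_1, D_2 the difference operators
in the two coordinate directions, let [C] consist of the functions of degree
less than n, those killed by every D_1^i D_2^j with i + j >= n.  For a
function in [C], a difference D_1^i D_2^j with i + j = n - 1 is constant.
Translations do not change these n leading coefficients.  Nor does negating
a coordinate, as signs are invisible modulo 2, while exchanging the
coordinates exchanges (i, j) with (j, i).  So the sums of
the coefficients (j, n-1-j) and (n-1-j, j), for j < n/2, are invariant.  Over
F_2 one has D^n = 0 and D^(n-1) sums over a full period, so differences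
of the indicator function of the origin lie in [C] and realise every
value of these n/2 invariants ([leading_form_onto]).  Thus valency 8 occurs
with groups that need at least n/2 generators. *)

Set Implicit Arguments.
Unset Strict Implicit.
Unset Printing Implicit Defensive.

Import GRing.Theory.
Local Open Scope ring_scope.

(** * Lower bounds on generating sets, and counting *)

(** The elements mapped into the span of the images of a generating set form
a subgroup containing that set, so this span is the whole space. *)
Lemma size_generates_ge (G : groupType) (K : fieldType) (t : nat)
    (lam : G -> 'rV[K]_t) (s : seq G) :
  (forall g h, lam (g * h)%g = lam g + lam h) ->
  (forall j, exists g, lam g = delta_mx 0 j) ->
  generates s -> (t <= size s)%N.
Proof.
move=> lamM lam_onto gen_s.
pose W := <<[seq lam g | g <- s]>>%VS.
have lam1 : lam 1%g = 0.
  by apply: (addIr (lam 1%g)); rewrite add0r -lamM mulg1.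
have lamV g : lam g^-1%g = - lam g.
  by apply: (addIr (lam g)); rewrite addNr -lamM mulVg.
have inW g : lam g \in W.
  suff : [set h | lam h \in W]%classic g by [].
  have : generated_subgroup [set` s]%classic g by rewrite gen_s.
  apply; split=> [|h hs]; last by apply/memv_span/map_f.
  split=> [|x y]; rewrite !inE /=; first by rewrite lam1 mem0v.
  by move=> xW yW; rewrite lamM lamV memvB.
have /dimvS : (fullv <= W)%VS.
  apply/subvP => u _; rewrite (row_sum_delta u) memv_suml // => j _.
  by rewrite memvZ //; have [g <-] := lam_onto j.
rewrite dimvf /dim /= mul1n => /leq_trans -> //.
by rewrite -(size_map lam) dim_span.
Qed.

Lemma addr2_F2 (x : 'F_2) : x + x = 0.
Proof. by case: x => [[|[|[]]]] //= i; apply/val_inj. Qed.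

Lemma oppr_F2 (x : 'F_2) : - x = x.
Proof. by apply/esym/eqP; rewrite -addr_eq0 addr2_F2. Qed.

Lemma F2P (x : 'F_2) : x = 0 \/ x = 1.
Proof.
by case: x => [[|[|[]]]] //= i; [left | right]; apply/val_inj.
Qed.

Lemma card_eq_finpred (T : finType) (A : {pred T}) :
  ([set` A]%classic #= `I_#|A|)%card.
Proof.
rewrite (card_eqr card_II).
have -> : [set` A]%classic = (@enum_val T (mem A) @` setT)%classic.
  apply/seteqP; split=> [x /= xA|_ [i _ <-]] /=; last exact: enum_valP.
  by exists (enum_rank_in xA x) => //; rewrite enum_rankK_in.
by apply: inj_card_eq => i j _ _; apply: enum_val_inj.
Qed.

(** * Doubling the vertices of an arc-transitive graph *)

Section Cover.

Variables (V : finType) (e : rel V) (C : set (V -> 'F_2)) (t : nat).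
Variable lam : (V -> 'F_2) -> 'rV['F_2]_t.

(** Instead of fixing a group [X], all symmetries of the base graph that
preserve [C] and [lam] are used at once. *)
Definition base_symmetry (h : V -> V) : Prop :=
  [/\ injective h, forall v w, e (h v) (h w) = e v w &
      forall c, C c -> C (c \o h) /\ lam (c \o h) = lam c].

Lemma base_symmetry_id : base_symmetry id.
Proof. by split. Qed.

Lemma base_symmetry_comp h k :
  base_symmetry h -> base_symmetry k -> base_symmetry (k \o h).
Proof.
move=> [hI hE hC] [kI kE kC]; split=> [|v w|c Cc].
- exact: inj_comp.
- by rewrite /= kE hE.
- by have [Ck <-] := kC c Cc; exact: (hC _ Ck).
Qed.

Hypotheses (e_sym : symmetric e) (e_irr : irreflexive e).
Hypotheses (C0 : C 0) (C1 : C (fun=> 1)).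
Hypothesis CD : forall c c', C c -> C c' -> C (c + c').
Hypothesis lamD : {morph lam : c c' / c + c'}.

Let T : finType := (V * 'F_2)%type.

(** The elements of the extension [C : X] as permutations: [g] induces [h] on
the base and adds [c v] on the fibre over [v]. *)
Definition lifts (h : V -> V) (c : V -> 'F_2) (g : {perm T}) : Prop :=
  forall v i, g (v, i) = (h v, i + c v).

Definition cover_set : {set {perm T}} :=
  [set g | `[< exists h c, [/\ base_symmetry h, C c & lifts h c g] >]].

Lemma cover_setP g :
  reflect (exists h c, [/\ base_symmetry h, C c & lifts h c g])
          (g \in cover_set).
Proof. by rewrite inE; apply: asboolP. Qed.

Lemma lifts_mul h c g h' c' g' :
  lifts h c g -> lifts h' c' g' -> lifts (h' \o h) (c + (c' \o h)) (g * g')%g.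
Proof. by move=> gE g'E v i; rewrite permM gE g'E addrfctE /= addrA. Qed.

Lemma cover_group_set : group_set cover_set.
Proof.
apply/group_setP; split=> [|g g' /cover_setP[h [c [hX Cc gE]]]].
  apply/cover_setP; exists id, 0; split=> //; first exact: base_symmetry_id.
  by move=> v i; rewrite perm1 /= addr0.
move=> /cover_setP[h' [c' [h'X Cc' g'E]]].
apply/cover_setP; exists (h' \o h), (c + (c' \o h)); split.
- exact: base_symmetry_comp.
- by apply: CD => //; case: hX => _ _ /(_ _ Cc')[].
- exact: lifts_mul.
Qed.

Canonical cover_group := Group cover_group_set.

Lemma exists_lift h c :
  base_symmetry h -> C c -> exists2 g, g \in cover_group & lifts h c g.
Proof.
move=> hX Cc.
have injF : injective (fun p : T => (h p.1, p.2 + c p.1)).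
  move=> [v i] [w j] /pair_equal_spec[/= hvw]; have [hI _ _] := hX.
  by rewrite (hI _ _ hvw) => /addIr ->.
have gE : lifts h c (perm injF) by move=> v i; rewrite permE.
by exists (perm injF) => //; apply/cover_setP; exists h, c.
Qed.

(** This recovers [c] from a lift of [(h, c)], without reference to [h]. *)
Definition voltage (g : {perm T}) : V -> 'F_2 := fun v => (g (v, 0)).2.

Lemma voltageE h c g : lifts h c g -> voltage g = c.
Proof. by move=> gE; apply/funext => v; rewrite /voltage gE /= add0r. Qed.

(** The voltage itself is only a crossed homomorphism; invariance of [lam]
removes the twist. *)
Lemma lam_voltageM : {in cover_group &, forall g g',
  lam (voltage (g * g')) = lam (voltage g) + lam (voltage g')}.
Proof.
move=> g g' /cover_setP[h [c [hX Cc gE]]] /cover_setP[h' [c' [_ Cc' g'E]]].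
rewrite (voltageE (lifts_mul gE g'E)) (voltageE gE) (voltageE g'E) lamD.
by case: hX => _ _ /(_ _ Cc')[_ ->].
Qed.

Definition cover_adj : rel T := fun p q => e p.1 q.1.

Lemma cover_adj_sym : symmetric cover_adj.
Proof. by move=> p q; apply: e_sym. Qed.

Lemma cover_adj_irr : irreflexive cover_adj.
Proof. by move=> p; apply: e_irr. Qed.

Definition cover_graph : sgraph := SGraph cover_adj_sym cover_adj_irr.

(** The product of permutations applies its left factor first, so the inverse
is what turns evaluation into a left action. *)
Definition cover_act (g : [subg cover_group]) (p : cover_graph) :
  cover_graph := (sgval g)^-1%g p.

Lemma cover_faithful_action : faithful_graph_action cover_act.
Proof.
split=> [p|g g' p|g p q|g gfix].
- by rewrite /cover_act /= invg1 perm1.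
- by rewrite /cover_act /= invMg permM.
- rewrite /cover_act; case: p q => [v i] [w j].
  have /cover_setP[h [c [[_ hE _] _ gE]]] : (sgval g)^-1%g \in cover_group.
    by rewrite groupV subgP.
  by rewrite /= /cover_adj !gE /= hE.
- apply: subg_inj; apply/permP => p /=; rewrite perm1.
  by rewrite -{1}[p]gfix /cover_act permKV.
Qed.

Hypothesis e_transitive : forall v w v' w', e v w -> e v' w' ->
  exists h, [/\ base_symmetry h, h v = v' & h w = w'].
Hypothesis C_separates : forall v w, e v w -> exists2 c, C c & c v <> c w.

(** Over a given edge, [C] acts transitively on the pairs of fibre values. *)
Lemma C_interpolates v w (a b : 'F_2) :
  e v w -> exists c, [/\ C c, c v = a & c w = b].
Proof.
move=> evw; have [c Cc cvw] := C_separates evw.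
have [] := F2P a; have [] := F2P b; have [] := F2P (c v); have [] := F2P (c w);
  move=> cw cv -> ->; try by rewrite cv cw in cvw.
all: first [by exists 0 | by exists (fun=> 1) | by exists c |
  by exists (c + fun=> 1); split; [exact: CD| |] => //=;
     rewrite ?addrfctE ?cv ?cw ?addr2_F2 ?add0r].
Qed.

Lemma cover_transitive : transitive_on_arcs cover_act.
Proof.
move=> [v i] [w j] [v' i'] [w' j'] /= evw evw'.
have [h [hX hv hw]] := e_transitive evw evw'; rewrite /= in hv hw.
have [c [Cc cv cw]] := C_interpolates (i' - i) (j' - j) evw.
have [g gG gE] := exists_lift hX Cc.
exists (subg cover_group g^-1%g).
rewrite /cover_act subgK ?groupV //= invgK !gE hv hw cv cw.
by rewrite ![_ + (_ - _)]addrC !subrK.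
Qed.

Variable m : nat.
Hypothesis e_connected : forall v w, connect e v w.
Hypothesis e_degree : forall v, #|e v| = m.+1.
Hypothesis V_inhabited : inhabited V.

Lemma exists_neighbour v : exists w, e v w.
Proof.
have /card_gt0P[w] : (0 < #|e v|)%N by rewrite e_degree.
by exists w.
Qed.

(** Walks of the base lift step by step; the two points of one fibre are
joined through a common neighbour. *)
Lemma cover_connect v w i j : connect cover_adj (v, i) (w, j).
Proof.
have lift1 (x y : V) k : e x y -> connect cover_adj (x, k) (y, j).
  by move=> exy; apply: connect1.
have vertical x k : connect cover_adj (x, k) (x, j).
  have [y exy] := exists_neighbour x.
  apply: connect_trans (lift1 x y k exy) _.
  by apply: lift1; rewrite e_sym.
have /connectP[p] := e_connected v w.
elim: p v i => [|y p IHp] v i /= => [_ ->|/andP[evy yp] wE].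
  exact: vertical.
by apply: connect_trans (lift1 v y i evy) _; apply: IHp.
Qed.

Lemma cover_connected : connected_graph cover_graph.
Proof.
split; first by case: V_inhabited => v; exists; exact: (v, 0).
move=> [v i] [w j]; have /connectP[p] := cover_connect v w i j.
by exists p.
Qed.

Lemma cover_arc_transitive : arc_transitive_graph cover_act.
Proof.
split.
- by move=> p; apply: finite_finset.
- exact: cover_connected.
- exact: cover_faithful_action.
- exact: cover_transitive.
- by move=> p; apply: finite_finset.
Qed.

Lemma cover_valency : has_valency cover_graph (m.+1).*2.
Proof.
move=> p; have -> : (m.+1).*2 = #|[pred q | cover_adj p q]|.
  rewrite -muln2 -(e_degree p.1) -{2}(card_Fp (isT : prime 2)) -cardX.
  by apply: eq_card => q; rewrite !inE andbT.
exact: (card_eq_finpred [pred q | cover_adj p q]).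
Qed.

Hypothesis lam_onto : forall j, exists2 c, C c & lam c = delta_mx 0 j.

Lemma exists_arc_transitive_of_large_rank :
  exists (Gam : sgraph) (G : groupType) (act : G -> Gam -> Gam),
    [/\ arc_transitive_graph act, has_valency Gam (m.+1).*2 &
        forall s : seq G, generates s -> (t <= size s)%N].
Proof.
exists cover_graph, [subg cover_group], cover_act; split.
- exact: cover_arc_transitive.
- exact: cover_valency.
move=> s; apply: (@size_generates_ge _ _ t (fun g => lam (voltage (sgval g)))).
  by move=> g g' /=; rewrite lam_voltageM ?subgP.
move=> j; have [c Cc <-] := lam_onto j.
have [g gG gE] := exists_lift base_symmetry_id Cc.
by exists (subg cover_group g); rewrite subgK // (voltageE gE).
Qed.

End Cover.

(** * Difference operators modulo 2 *)

Section Differences.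

Variable A : zmodType.
Implicit Types (a b v : A) (f g : A -> 'F_2).

Definition diff a f : A -> 'F_2 := fun v => f (v + a) - f v.

Lemma diffE a f v : diff a f v = f (v + a) + f v.
Proof. by rewrite /diff oppr_F2. Qed.

Lemma diff0 a : diff a 0 = 0.
Proof. by apply/funext => v; rewrite diffE addr2_F2. Qed.

Lemma diff_cst a x : diff a (fun=> x) = 0.
Proof. by apply/funext => v; rewrite diffE addr2_F2. Qed.

Lemma iter_diff0 a i : iter i (diff a) 0 = 0.
Proof. by elim: i => //= i ->; apply: diff0. Qed.

Lemma iter_diffD a i f g :
  iter i (diff a) (f + g) = iter i (diff a) f + iter i (diff a) g.
Proof.
elim: i => //= i ->; apply/funext => v.
by rewrite !addrfctE !diffE addrACA.
Qed.

Lemma diffC a b f : diff a (diff b f) = diff b (diff a f).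
Proof. by apply/funext => v; rewrite !diffE addrACA [v + b + a]addrAC. Qed.

Lemma iter_diffC a b i j f :
  iter i (diff a) (iter j (diff b) f) = iter j (diff b) (iter i (diff a) f).
Proof.
have iter1 k g : iter k (diff a) (diff b g) = diff b (iter k (diff a) g).
  by elim: k => //= k ->; apply: diffC.
by elim: j => //= j IHj; rewrite iter1 IHj.
Qed.

Lemma iter_diff_comp (L : A -> A) a b i f :
  (forall v, L (v + a) = L v + b) ->
  iter i (diff a) (f \o L) = iter i (diff b) f \o L.
Proof.
move=> LD; elim: i => //= i ->; apply/funext => v.
by rewrite /= !diffE /= LD.
Qed.

(** A difference in the direction [- a] is minus a translated difference in the
direction [a], and the sign vanishes modulo 2. *)
Lemma iter_diffN a i f :
  iter i (diff (- a)) f = iter i (diff a) f \o (fun v => v - a *+ i).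
Proof.
elim: i => [|i IHi]; first by apply/funext => v; rewrite /= mulr0n subr0.
apply/funext => v; rewrite /= IHi !diffE /= mulrSr opprD addrA subrK.
by rewrite [RHS]addrC [v - a - _]addrAC.
Qed.

Lemma diff_eq0_periodic a f v i : diff a f = 0 -> f (v + a *+ i) = f v.
Proof.
move=> /funeqP df0; elim: i => [|i <-]; first by rewrite mulr0n addr0.
by apply/eqP; rewrite mulrSr addrA -subr_eq0; apply/eqP/df0.
Qed.

(** With [S] the shift by [a], this is (S - 1)^(2^k) = S^(2^k) + 1. *)
Lemma iter_diff_expn2 a k f :
  iter (2 ^ k) (diff a) f = fun v => f (v + a *+ (2 ^ k)) + f v.
Proof.
elim: k f => [|k IHk] f; first by apply/funext => v; rewrite /= diffE mulr1n.
rewrite expnS mul2n -addnn iterD !IHk; apply/funext => v.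
by rewrite mulrnDr !addrA -[_ + f (v + _) + f (v + _)]addrA addr2_F2 addr0.
Qed.

(** With [S] the shift by [a], this is
(S - 1)^(2^k - 1) = 1 + S + ... + S^(2^k - 1). *)
Lemma iter_diff_expn2_pred a k f v :
  iter (2 ^ k).-1 (diff a) f v = \sum_(i < 2 ^ k) f (v + a *+ i).
Proof.
elim: k f => [|k IHk] f; first by rewrite big_ord1 mulr0n addr0.
have -> : (2 ^ k.+1).-1 = ((2 ^ k).-1 + 2 ^ k)%N.
  by rewrite expnS mul2n -addnn -!subn1 addnBAC ?expn_gt0.
rewrite iterD IHk iter_diff_expn2 big_split /= addrC expnS mul2n -addnn.
rewrite big_split_ord /=; congr (_ + _).
by apply: eq_bigr => i _; rewrite -addrA -mulrnDr addnC.
Qed.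

End Differences.

(** * Functions of low degree on the torus *)

Section Torus.

Variable k : nat.
Local Notation n := (2 ^ k.+2)%N.
Local Notation t := (2 ^ k.+1)%N.
Local Notation V := ('Z_n * 'Z_n)%type.

Let e1 : V := (1, 0).
Let e2 : V := (0, 1).

Lemma nE : n = (t + t)%N.
Proof. by rewrite expnS mul2n addnn. Qed.

Lemma t_gt1 : (1 < t)%N.
Proof. by rewrite -{1}(expn0 2) ltn_exp2l. Qed.

Lemma n_gt2 : (2 < n)%N.
Proof. by have := t_gt1; rewrite nE; lia. Qed.

Lemma n_gt1 : (1 < n)%N.
Proof. exact: ltnW n_gt2. Qed.

Lemma e1n i : e1 *+ i = (i%:R, 0).
Proof. by rewrite pairMnE /= mul0rn. Qed.

Lemma e2n i : e2 *+ i = (0, i%:R).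
Proof. by rewrite pairMnE /= mul0rn. Qed.

Lemma torusE (v : V) : v = e1 *+ (v.1 : nat) + e2 *+ (v.2 : nat).
Proof.
rewrite e1n e2n; case: v => x y; congr (_, _) => /=.
  by rewrite addr0 natr_Zp.
by rewrite add0r natr_Zp.
Qed.

Definition mixed_diff i j (c : V -> 'F_2) : V -> 'F_2 :=
  iter i (diff e1) (iter j (diff e2) c).

(** The analogue modulo [n] of the polynomial functions of total degree less
than [n]. *)
Definition low_degree : set (V -> 'F_2) :=
  [set c | forall i j, (n <= i + j)%N -> mixed_diff i j c = 0]%classic.

(** Adding the coefficients of exponents (j, n-1-j) and (n-1-j, j) makes the
form invariant under the exchange of the two coordinates. *)
Definition leading_form (c : V -> 'F_2) : 'rV['F_2]_t :=
  \row_j (mixed_diff j (n.-1 - j) c 0 + mixed_diff (n.-1 - j) j c 0).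

Lemma mixed_diffD i j c c' :
  mixed_diff i j (c + c') = mixed_diff i j c + mixed_diff i j c'.
Proof. by rewrite /mixed_diff !iter_diffD. Qed.

Lemma mixed_diff_mixed i j i' j' c :
  mixed_diff i j (mixed_diff i' j' c) = mixed_diff (i + i') (j + j') c.
Proof. by rewrite /mixed_diff iter_diffC -!iterD iter_diffC -iterD. Qed.

Lemma mixed_diff_large i j c :
  (n <= i)%N || (n <= j)%N -> mixed_diff i j c = 0.
Proof.
have diff_n i0 e f : (e = e1) \/ (e = e2) -> (n <= i0)%N ->
    iter i0 (diff e) f = 0.
  move=> eE /subnK <-; rewrite iterD iter_diff_expn2.
  have -> : e *+ n = 0.
    by case: eE => ->; rewrite ?e1n ?e2n pchar_Zp ?n_gt1.
  rewrite -[RHS](iter_diff0 e (i0 - n)); congr iter; apply/funext => v.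
  by rewrite addr0 addr2_F2.
case/orP=> le_n; rewrite /mixed_diff; first by apply: diff_n; [left|].
by rewrite (diff_n j) ?iter_diff0; [|right|].
Qed.

(** Both first differences of a difference of top order vanish, so it is
periodic under [e1] and [e2], which generate the torus. *)
Lemma mixed_diff_cst c i j v :
  low_degree c -> (n.-1 <= i + j)%N -> mixed_diff i j c v = mixed_diff i j c 0.
Proof.
move=> Cc le_n; have lt_n : (n <= (i + j).+1)%N by have := n_gt1; lia.
have d1 : diff e1 (mixed_diff i j c) = 0.
  by apply: (Cc i.+1 j); rewrite addSn.
have d2 : diff e2 (mixed_diff i j c) = 0.
  rewrite /mixed_diff iter_diffC -iterS -iter_diffC.
  by apply: (Cc i j.+1); rewrite addnS.
rewrite (torusE v) (diff_eq0_periodic _ _ d2).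
by rewrite -[e1 *+ _]add0r (diff_eq0_periodic _ _ d1).
Qed.

Lemma low_degree0 : low_degree 0.
Proof. by move=> i j _; rewrite /mixed_diff !iter_diff0. Qed.

Lemma low_degreeD c c' : low_degree c -> low_degree c' -> low_degree (c + c').
Proof. by move=> Cc Cc' i j le_n; rewrite mixed_diffD Cc ?Cc' ?addr0. Qed.

Lemma leading_formD : {morph leading_form : c c' / c + c'}.
Proof.
by move=> c c'; apply/rowP => j; rewrite !mxE !mixed_diffD !addrfctE addrACA.
Qed.

Lemma low_degree_cst x : low_degree (fun=> x).
Proof.
move=> i j le_n; rewrite /mixed_diff.
case: j le_n => [|j] le_n; last by rewrite iterSr diff_cst !iter_diff0.
case: i le_n => [|i] le_n; last by rewrite iterSr diff_cst !iter_diff0.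
by have := n_gt1; lia.
Qed.

Definition mod2 (x : 'Z_n) : 'F_2 := (x : nat)%:R.

Lemma mod2_natr i : mod2 i%:R = i%:R.
Proof.
rewrite /mod2 val_Zp_nat ?n_gt1 // -[RHS](@Fp_nat_mod 2) //.
by rewrite -(@modn_dvdm n i 2) ?(@Fp_nat_mod 2) // expnS dvdn_mulr.
Qed.

Lemma mod2D : {morph mod2 : x y / x + y}.
Proof.
by move=> x y; rewrite -[x]natr_Zp -[y]natr_Zp -natrD !mod2_natr natrD.
Qed.

(** The checkerboard colouring: of degree 1, and separating the ends of every
edge. *)
Definition parity (v : V) : 'F_2 := mod2 v.1 + mod2 v.2.

Lemma parityD v w : parity (v + w) = parity v + parity w.
Proof. by rewrite /parity [(v + w).1]/= [(v + w).2]/= !mod2D addrACA. Qed.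

Lemma parity_e1 : parity e1 = 1.
Proof. by rewrite /parity (mod2_natr 1) (mod2_natr 0) addr0. Qed.

Lemma parity_e2 : parity e2 = 1.
Proof. by rewrite /parity (mod2_natr 1) (mod2_natr 0) add0r. Qed.

Lemma low_degree_parity : low_degree parity.
Proof.
have d1 : diff e1 parity = fun=> 1.
  by apply/funext => v; rewrite /diff parityD parity_e1 addrAC subrr add0r.
have d2 : diff e2 parity = fun=> 1.
  by apply/funext => v; rewrite /diff parityD parity_e2 addrAC subrr add0r.
move=> i j le_n; have n1 := n_gt1; rewrite /mixed_diff.
case: j le_n => [|[|j]] le_n.
- case: i le_n => [|[|i]] le_n; first lia.
    by have := n_gt2; lia.
  by rewrite iterSr d1 iterSr diff_cst iter_diff0.
- case: i le_n => [|i] le_n; first by lia.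
  by rewrite [iter 1 _ _]d2 iterSr diff_cst iter_diff0.
- by rewrite iterSr d2 iterSr diff_cst !iter_diff0.
Qed.

Definition delta0 : V -> 'F_2 := fun v => (v == 0)%:R.

(** This difference is the sum of [delta0] over the whole torus. *)
Lemma mixed_diff_delta0 : mixed_diff n.-1 n.-1 delta0 0 = 1.
Proof.
rewrite /mixed_diff iter_diff_expn2_pred.
have n_gt0 : (0 < n)%N by exact: ltnW n_gt1.
have valn (i : 'I_n) : (i%:R : 'Z_n) = i :> nat.
  by rewrite val_Zp_nat ?n_gt1 // modn_small.
rewrite (bigD1 (Ordinal n_gt0)) //= [X in _ + X]big1 => [|i i_neq0].
  rewrite iter_diff_expn2_pred (bigD1 (Ordinal n_gt0)) //= big1 => [|j j_neq0].
    by rewrite /delta0 !mulr0n !addr0 eqxx.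
  rewrite /delta0 mulr0n !add0r e2n; case: eqP => // /pair_equal_spec[_ j0].
  by case/eqP: j_neq0; apply: val_inj; rewrite /= -valn j0.
rewrite iter_diff_expn2_pred big1 // => j _; rewrite /delta0 add0r e1n e2n.
case: eqP => // /pair_equal_spec[/= i0 _].
by case/eqP: i_neq0; apply: val_inj; rewrite /= -valn -[i%:R]addr0 i0.
Qed.

(** For D_1^(n-1-j) D_2^j applied to [delta0], the coefficient of exponents
(i, n-1-i) is D_1^(n-1+i-j) D_2^(n-1+j-i) at the origin; one of the two
exponents is at least [n] unless [i = j]. *)
Lemma leading_form_onto (j : 'I_t) :
  exists2 c, low_degree c & leading_form c = delta_mx 0 j.
Proof.
have tn := nE; have j_lt := ltn_ord j.
exists (mixed_diff (n.-1 - j) j delta0) => [i l le_n|].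
  by rewrite mixed_diff_mixed mixed_diff_large //; lia.
apply/rowP => i; rewrite !mxE /= !mixed_diff_mixed.
have i_lt := ltn_ord i.
(* The mirror term has first exponent (n-1-i) + (n-1-j) >= n, as i, j < n/2. *)
rewrite [X in _ + X 0]mixed_diff_large ?addr0; last by lia.
case: (ltngtP i j) => [lt_ij|gt_ij|eq_ij].
- rewrite mixed_diff_large; last by lia.
  by case: eqP => // ij; rewrite ij ltnn in lt_ij.
- rewrite mixed_diff_large; last by lia.
  by case: eqP => // ij; rewrite ij ltnn in gt_ij.
- rewrite (val_inj eq_ij) eqxx subnKC ?subnK ?mixed_diff_delta0 //; lia.
Qed.

(** * Symmetries of the torus grid *)

Definition torus_adj : rel V :=
  fun v w => w - v \in [:: e1; - e1; e2; - e2].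

Let symmetry := base_symmetry torus_adj low_degree leading_form.

(** The reparametrisation [q] is harmless: membership asks for differences that
vanish identically, and those entering the leading form are constant. *)
Lemma symmetry_of_mixed_diff (h : V -> V) (swaps : bool) :
  injective h -> (forall v w, torus_adj (h v) (h w) = torus_adj v w) ->
  (forall i j c, exists q, mixed_diff i j (c \o h) =
     (if swaps then mixed_diff j i c else mixed_diff i j c) \o q) ->
  symmetry h.
Proof.
move=> hI hE hC; split=> // c Cc; split=> [i j le_n|].
  have [q ->] := hC i j c.
  by case: swaps {hC} => //; rewrite Cc // addnC.
apply/rowP => j; rewrite !mxE; have j_lt := ltn_ord j; have tn := nE.
have [q1 ->] := hC j (n.-1 - j)%N c; have [q2 ->] := hC (n.-1 - j)%N j c.
by case: swaps {hC} => /=; rewrite !(@mixed_diff_cst _ _ _ (_ 0)) //;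
  [rewrite addrC | lia..].
Qed.

Lemma symmetry_translation a : symmetry (fun v => v + a).
Proof.
apply: (@symmetry_of_mixed_diff _ false) => [|v w|i j c]; first exact: addIr.
  by rewrite /torus_adj opprD addrACA subrr addr0.
have trD d v : v + d + a = v + a + d by exact: addrAC.
exists (fun v => v + a); rewrite /mixed_diff.
by rewrite !(@iter_diff_comp _ (fun v => v + a) _ _ _ _ (trD _)).
Qed.

Definition reflection (v : V) : V := (- v.1, v.2).

Lemma reflection_e1 : reflection e1 = - e1.
Proof. by rewrite /reflection /e1 /=; congr (_, _); rewrite oppr0. Qed.

Lemma symmetry_reflection : symmetry reflection.
Proof.
have rD v w : reflection (v + w) = reflection v + reflection w.
  by case: v w => [x y] [x' y']; rewrite /reflection /= opprD.
have rK : involutive reflection.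
  by case=> x y; rewrite /reflection /= opprK.
have rN v : reflection (- v) = - reflection v by [].
have r2 : reflection e2 = e2 by rewrite /reflection /e2 /= oppr0.
apply: (@symmetry_of_mixed_diff _ false) => [|v w|i j c].
- exact: inv_inj rK.
- rewrite /torus_adj -rN -rD !inE.
  rewrite -!(inj_eq (inv_inj rK) (w - v)) !rN reflection_e1 r2 opprK.
  by rewrite orbCA.
- exists ((fun v => v - e1 *+ i) \o reflection); rewrite /mixed_diff.
  rewrite (@iter_diff_comp _ _ e2 e2) => [|v]; last by rewrite rD r2.
  rewrite (@iter_diff_comp _ _ e1 (- e1)) => [|v]; last first.
    by rewrite rD reflection_e1.
  by rewrite iter_diffN.
Qed.

Definition swap (v : V) : V := (v.2, v.1).

Lemma symmetry_swap : symmetry swap.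
Proof.
have sD v w : swap (v + w) = swap v + swap w by [].
have sK : involutive swap by case.
have sN v : swap (- v) = - swap v by [].
have s1 : swap e1 = e2 by [].
have s2 : swap e2 = e1 by [].
apply: (@symmetry_of_mixed_diff _ true) => [|v w|i j c].
- exact: inv_inj sK.
- rewrite /torus_adj -sN -sD !inE.
  rewrite -!(inj_eq (inv_inj sK) (w - v)) !sN s1 s2.
  by do 4 case: (_ == _).
- exists swap; rewrite /mixed_diff.
  rewrite (@iter_diff_comp _ _ e2 e1) => [|v]; last by rewrite sD s2.
  rewrite (@iter_diff_comp _ _ e1 e2) => [|v]; last by rewrite sD s1.
  by rewrite iter_diffC.
Qed.

(** Any direction is carried to any other through [e1]. *)
Lemma symmetry_direction d : d \in [:: e1; - e1; e2; - e2] ->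
  (exists L, [/\ symmetry L, L 0 = 0 & L d = e1]) /\
  (exists L, [/\ symmetry L, L 0 = 0 & L e1 = d]).
Proof.
have r0 : reflection 0 = 0 by rewrite /reflection /= oppr0.
have rN1 : reflection (- e1) = e1.
  by rewrite /reflection /e1 /= opprK; congr (_, _); rewrite oppr0.
have symr := symmetry_reflection; have syms := symmetry_swap.
rewrite !inE => /or4P[] /eqP ->.
- by split; exists id; split=> //; apply: base_symmetry_id.
- by split; exists reflection; split=> //; apply: reflection_e1.
- by split; exists swap.
- split; [exists (reflection \o swap) | exists (swap \o reflection)].
  all: split=> //=.
  + exact: base_symmetry_comp.
  + exact: base_symmetry_comp.
  + by rewrite r0.
  + by rewrite reflection_e1.
Qed.

Lemma torus_transitive v w v' w' : torus_adj v w -> torus_adj v' w' ->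
  exists h, [/\ symmetry h, h v = v' & h w = w'].
Proof.
move=> /symmetry_direction[[L [symL L0 Ld]] _].
move=> /symmetry_direction[_ [L' [symL' L'0 L'd]]].
exists ((fun u => u + v') \o (L' \o (L \o (fun u => u - v)))); split=> /=.
- have tr := symmetry_translation.
  apply: (base_symmetry_comp _ (tr v')); apply: (base_symmetry_comp _ symL').
  exact: base_symmetry_comp (tr (- v)) symL.
- by rewrite subrr L0 L'0 add0r.
- by rewrite Ld L'd subrK.
Qed.

Lemma torus_sym : symmetric torus_adj.
Proof.
move=> v w; rewrite /torus_adj !inE -[v - w]opprB !(eqr_oppLR (w - v)) !opprK.
by do 4 case: (_ == _).
Qed.

Lemma uniq_directions : uniq [:: e1; - e1; e2; - e2].
Proof.
have neq10 : ((1 : 'Z_n) == 0) = false by exact: oner_eq0.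
have neq01 : ((0 : 'Z_n) == 1) = false by rewrite eq_sym.
have neq1N : ((1 : 'Z_n) == -1) = false.
  rewrite -addr_eq0 -(natrD _ 1 1); apply/eqP => /(congr1 (@nat_of_ord _)).
  by rewrite val_Zp_nat ?n_gt1 // modn_small ?n_gt2.
have neq0N : ((0 : 'Z_n) == -1) = false by rewrite eq_sym oppr_eq0.
rewrite /= !inE /e1 /e2 !xpair_eqE /= !oppr0 oppr_eq0.
by rewrite neq10 neq01 neq1N neq0N.
Qed.

Lemma torus_irr : irreflexive torus_adj.
Proof.
move=> v; rewrite /torus_adj subrr !inE !(eq_sym (0 : V)) !oppr_eq0.
by rewrite /e1 /e2 !xpair_eqE oner_eq0 andbF.
Qed.

Lemma torus_degree v : #|torus_adj v| = 4.
Proof.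
have <- : size [seq v + d | d <- [:: e1; - e1; e2; - e2]] = 4 by [].
rewrite -(card_uniqP _); last first.
  by rewrite map_inj_uniq ?uniq_directions //; apply: addrI.
by apply: eq_card => w; rewrite -[in RHS](subrKC v w) mem_map //; apply: addrI.
Qed.

Lemma torus_connected v w : connect torus_adj v w.
Proof.
have step d i u : d \in [:: e1; - e1; e2; - e2] ->
    connect torus_adj u (u + d *+ i).
  move=> dD; elim: i => [|i IHi]; first by rewrite mulr0n addr0.
  apply: connect_trans IHi _; apply: connect1.
  by rewrite /torus_adj mulrSr addrA [_ + d]addrC addrK.
rewrite -[w](subrKC v) (torusE (w - v)) addrA.
by apply: connect_trans (step e1 _ v _) (step e2 _ _ _);
  rewrite !inE eqxx ?orbT.
Qed.

Lemma parity_separates v w : torus_adj v w -> parity v <> parity w.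
Proof.
have parityN u : parity (- u) = parity u.
  by apply/eqP; rewrite -subr_eq0 oppr_F2 -parityD addNr.
move=> vw; rewrite -[w](subrKC v) parityD => /eqP.
rewrite -subr_eq0 opprD addrA subrr add0r oppr_F2.
by move: vw; rewrite /torus_adj !inE => /or4P[] /eqP ->;
  rewrite ?parityN ?parity_e1 ?parity_e2.
Qed.

(** * Groups of large rank in valency 8 *)

Lemma valency8_large_rank :
  exists (Gam : sgraph) (G : groupType) (act : G -> Gam -> Gam),
    [/\ arc_transitive_graph act, has_valency Gam 8 &
        forall s : seq G, generates s -> (t <= size s)%N].
Proof.
apply: (@exists_arc_transitive_of_large_rank V torus_adj low_degree t
          leading_form _ _ _ _ _ _ _ _ 3).
- exact: torus_sym.
- exact: torus_irr.
- exact: low_degree0.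
- exact: low_degree_cst.
- exact: low_degreeD.
- exact: leading_formD.
- exact: torus_transitive.
- move=> v w /parity_separates; exists parity => //.
  exact: low_degree_parity.
- exact: torus_connected.
- exact: torus_degree.
- by exists; exact: 0.
- exact: leading_form_onto.
Qed.

End Torus.

Theorem theorem1 :
  ~ exists f : nat -> nat,
      forall (d : nat) (Gam : sgraph) (G : groupType) (act : G -> Gam -> Gam),
        arc_transitive_graph act -> has_valency Gam d ->
        min_generators_le G (f d).
Proof.
move=> [f f_bounds].
have [Gam [G [act [arcG val8 large]]]] := valency8_large_rank (f 8).
have [_ [[s <- /large le_s] _] le_f] := f_bounds _ _ _ _ arcG val8.
have lt_f : (f 8 < 2 ^ (f 8).+1)%N by apply: ltnW; apply: ltn_expl.
by have := leq_trans le_s le_f; rewrite leqNgt lt_f.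
Qed.
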